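(* Let $A,B\in\mathbb{C}_{n,n}$. Then $A\mathop{\le}\limits^{(\dag)}B$ (core-EP order) if and only if $$AA^{(W)}=BA^{(W)}\quad\text{and}\quad A^\ast A^{(W)}=B^\ast A^{(W)} .$$
   Context: $\mathbb{C}_{m,n}$ is the set of complex $m\times n$ matrices and $A^\ast$ the conjugate transpose. The index $\mathrm{Ind}(A)$ is the smallest positive integer $k$ with $\mathrm{rk}(A^{k+1})=\mathrm{rk}(A^k)$. Core-EP decomposition (known): every $A\in\mathbb{C}_{n,n}$ with $\mathrm{Ind}(A)=k$ can be written uniquely as $A=A_1+A_2$ with $\mathrm{Ind}(A_1)=1$, $A_2^k=0$ and $A_1^\ast A_2=A_2A_1=0$, and there is a unitary $U$ with $A_1=U\begin{bmatrix}T&S\\0&0\end{bmatrix}U^\ast$, $A_2=U\begin{bmatrix}0&0\\0&N\end{bmatrix}U^\ast$, $T$ non-singular, $N$ nilpotent (blocks may be empty). The core-EP inverse of $A$ is $A^{(\dag)}=U\begin{bmatrix}T^{-1}&0\\0&0\end{bmatrix}U^\ast$ (independent of the choice of $U$). The core-EP order: $A\mathop{\le}\limits^{(\dag)}B$ means $A^{(\dag)}A=A^{(\dag)}B$ and $AA^{(\dag)}=BA^{(\dag)}$. The WG (weak group) inverse $A^{(W)}$ of $A$ is the unique $X\in\mathbb{C}_{n,n}$ satisfying $AX^2=X$ and $AX=A^{(\dag)}A$. *)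

(* Defs.v *)
From HB Require Import structures.
From mathcomp Require Import all_boot all_order all_algebra.
From mathcomp Require Import boolp classical_sets reals.
From mathcomp Require Import complex.

Set Implicit Arguments.
Unset Strict Implicit.
Unset Printing Implicit Defensive.

Import GRing.Theory Num.Theory.
Local Open Scope ring_scope.
Local Open Scope sesquilinear_scope.

Lemma mxrank_expS_le (F : fieldType) (n : nat) (A : 'M[F]_n) (k : nat) :
  (\rank (A ^+ k.+1) <= \rank (A ^+ k))%N.
Proof. by rewrite exprS mxrankM_maxr. Qed.

Lemma mxindex_exists (F : fieldType) (n : nat) (A : 'M[F]_n) :
  exists k, (0 < k)%N && (\rank (A ^+ k.+1) == \rank (A ^+ k)).
Proof.
have [[k kP]|nk] := pselect (exists k, (0 < k)%N && (\rank (A ^+ k.+1) == \rank (A ^+ k))).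
  by exists k.
have h j : (\rank (A ^+ j.+1) + j <= n)%N.
  elim: j => [|j IH]; first by rewrite addn0 rank_leq_row.
  apply: leq_trans IH; rewrite addnS ltn_add2r ltn_neqAle mxrank_expS_le andbT.
  by apply/negP => e; apply: nk; exists j.+1.
by have := h n.+1; rewrite addnS ltnNge leq_addl.
Qed.

Definition mxindex (F : fieldType) (n : nat) (A : 'M[F]_n) : nat :=
  ex_minn (mxindex_exists A).

Definition core_ep_decomposition (C : numClosedFieldType) (n : nat)
    (A A1 A2 : 'M[C]_n) : Prop :=
  [/\ A = A1 + A2, mxindex A1 = 1%N, A2 ^+ mxindex A = 0,
      A1^t* *m A2 = 0 & A2 *m A1 = 0].

(* U has its columns split as r + m with r + m = n, so it is a square unitary
   matrix and the block matrices need no cast; r or m may be 0. *)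
Definition core_ep_block_form (C : numClosedFieldType) (n r m : nat)
    (U : 'M[C]_(n, r + m)) (T : 'M[C]_r) (S : 'M[C]_(r, m)) (N : 'M[C]_m)
    (A1 A2 : 'M[C]_n) : Prop :=
  [/\ (r + m)%N = n /\ U \is unitarymx,
      T \in unitmx /\ (exists j, N ^+ j = 0),
      A1 = U *m block_mx T S 0 0 *m U^t* &
      A2 = U *m block_mx 0 0 0 N *m U^t*].

Definition is_core_ep_inverse (C : numClosedFieldType) (n : nat)
    (A X : 'M[C]_n) : Prop :=
  exists A1 A2 : 'M[C]_n, core_ep_decomposition A A1 A2 /\
  exists (r m : nat) (U : 'M[C]_(n, r + m)) (T : 'M[C]_r)
         (S : 'M[C]_(r, m)) (N : 'M[C]_m),
    core_ep_block_form U T S N A1 A2 /\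
    X = U *m block_mx (invmx T) 0 0 0 *m U^t*.

(* The default value 0 is never used: see core_ep_inverseP. *)
Definition core_ep_inverse (C : numClosedFieldType) (n : nat)
    (A : 'M[C]_n) : 'M[C]_n :=
  xget 0 [set X | is_core_ep_inverse A X]%classic.

Definition core_ep_le (C : numClosedFieldType) (n : nat)
    (A B : 'M[C]_n) : Prop :=
  core_ep_inverse A *m A = core_ep_inverse A *m B /\
  A *m core_ep_inverse A = B *m core_ep_inverse A.

Definition is_wg_inverse (C : numClosedFieldType) (n : nat)
    (A X : 'M[C]_n) : Prop :=
  A *m X ^+ 2 = X /\ A *m X = core_ep_inverse A *m A.

(* The default value 0 is never used: see wg_inverseP. *)
Definition wg_inverse (C : numClosedFieldType) (n : nat)
    (A : 'M[C]_n) : 'M[C]_n :=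
  xget 0 [set X | is_wg_inverse A X]%classic.

Lemma mxindexP (F : fieldType) (n : nat) (A : 'M[F]_n) :
  (0 < mxindex A)%N /\ \rank (A ^+ (mxindex A).+1) = \rank (A ^+ mxindex A).
Proof. by rewrite /mxindex; case: ex_minnP => k /andP[k0 /eqP]. Qed.

Lemma mxindex_min (F : fieldType) (n : nat) (A : 'M[F]_n) (k : nat) :
  (0 < k)%N -> \rank (A ^+ k.+1) = \rank (A ^+ k) -> (mxindex A <= k)%N.
Proof.
by move=> k0 /eqP kP; rewrite /mxindex; case: ex_minnP => j _; apply; rewrite k0.
Qed.

Lemma mxrankM_ker (F : fieldType) (n p q : nat) (A : 'M[F]_(p, n))
    (P : 'M[F]_(n, q)) (s : nat) (Z : 'M[F]_(q, s)) :
  \rank (A *m P) = \rank P -> A *m P *m Z = 0 -> P *m Z = 0.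
Proof.
move=> rk AZ; have /submxP[D ->] : (P <= A *m P)%MS.
  by have := mxrank_leqif_sup (submxMl A P) => -[_ <-]; rewrite rk.
by rewrite -mulmxA AZ mulmx0.
Qed.


Lemma expr_outer (R : pzRingType) (a x : R) (k : nat) :
  a * x ^+ 2 = x -> x = a ^+ k * x ^+ k.+1.
Proof.
move=> ax; elim: k => [|k IH]; first by rewrite mul1r expr1.
by rewrite -[k.+2]add2n exprD exprSr -mulrA (mulrA a) ax -exprS.
Qed.

Lemma expmx_outer (F : fieldType) (n : nat) (A X : 'M[F]_n) (k : nat) :
  A *m X ^+ 2 = X -> X = A ^+ k *m X ^+ k.+1.
Proof. by move=> AX; exact: expr_outer. Qed.

Lemma outer_inj (F : fieldType) (n : nat) (A X Y : 'M[F]_n) :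
  A *m X ^+ 2 = X -> A *m Y ^+ 2 = Y -> A *m X = A *m Y -> X = Y.
Proof.
move=> AX AY AXY; have [_ rk] := mxindexP A.
apply/eqP; rewrite -subr_eq0; apply/eqP; pose k := mxindex A.
have -> : X - Y = A ^+ k *m (X ^+ k.+1 - Y ^+ k.+1).
  by rewrite mulmxBr -!expmx_outer.
apply: (@mxrankM_ker _ _ _ _ A); first by rewrite -[A *m _]exprS.
by rewrite -mulmxA mulmxBr -!expmx_outer // mulmxBr AXY subrr.
Qed.

Lemma trCmx_mul (C : numClosedFieldType) (m n p : nat)
    (A : 'M[C]_(m, n)) (B : 'M[C]_(n, p)) :
  (A *m B)^t* = B^t* *m A^t*.
Proof. by rewrite trmx_mul map_mxM. Qed.

Lemma unitarymx_trC (C : numClosedFieldType) (m n : nat) (M : 'M[C]_(m, n)) :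
  m = n -> M \is unitarymx -> M^t* \is unitarymx.
Proof. by move=> e; case: _ / e M => M; rewrite trmxC_unitary. Qed.

Lemma unitary_tCmul (C : numClosedFieldType) (m n : nat) (M : 'M[C]_(m, n)) :
  m = n -> M \is unitarymx -> M^t* *m M = 1%:M.
Proof. by move=> e /(unitarymx_trC e) /unitarymxP; rewrite trmxCK. Qed.

Lemma core_ep_block_props (C : numClosedFieldType) (n r m : nat)
    (A A1 A2 : 'M[C]_n) (U : 'M[C]_(n, r + m)) (T : 'M[C]_r)
    (S : 'M[C]_(r, m)) (N : 'M[C]_m) :
  core_ep_decomposition A A1 A2 -> core_ep_block_form U T S N A1 A2 ->
  let X := U *m block_mx (invmx T) 0 0 0 *m U^t* in
  [/\ A *m X ^+ 2 = X, (A *m X)^t* = A *m X &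
      A *m X *m A ^+ mxindex A = A ^+ mxindex A].
Proof.
move=> [eA _ A2k _ A21] [[e Uu] [Tu _] e1 e2] X.
have UU : U^t* *m U = 1%:M by apply: unitary_tCmul.
have AX : A *m X = U *m block_mx 1%:M 0 0 0 *m U^t*.
  rewrite eA e1 e2 -mulmxDl -mulmxDr add_block_mx /X !mulmxA.
  rewrite -[_ *m U^t* *m U]mulmxA UU mulmx1 -[U *m _ *m _]mulmxA mulmx_block.
  by rewrite !(mulmx0, mul0mx, addr0, add0r, mulmxV).
have PX : A *m X *m X = X.
  rewrite AX /X !mulmxA -[_ *m U^t* *m U]mulmxA UU mulmx1.
  rewrite -[U *m _ *m _]mulmxA mulmx_block.
  by rewrite !(mulmx0, mul0mx, addr0, add0r, mul1mx).
have PA1 : A *m X *m A1 = A1.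
  rewrite AX e1 !mulmxA -[_ *m U^t* *m U]mulmxA UU mulmx1.
  rewrite -[U *m _ *m _]mulmxA mulmx_block.
  by rewrite !(mulmx0, mul0mx, addr0, add0r, mul1mx).
split=> //; first by rewrite -[X ^+ 2]/(X *m X) mulmxA.
  rewrite AX !trCmx_mul trmxCK tr_block_mx map_block_mx mulmxA.
  by rewrite !trmx0 trmx1 !map_mx0 map_mx1.
suff h k : exists Z, A ^+ k = A1 *m Z + A2 ^+ k.
  by have [Z ->] := h (mxindex A); rewrite A2k addr0 mulmxA PA1.
elim: k => [|k [Z IH]]; first by exists 0; rewrite mulmx0 add0r.
exists (A1 *m Z + A2 ^+ k).
rewrite exprS IH -[A * _]/(A *m _) {1}eA mulmxDl; congr (_ + _).
by rewrite mulmxDr mulmxA A21 mul0mx add0r -[A2 *m _]exprS.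
Qed.

Lemma is_core_ep_inverse_props (C : numClosedFieldType) (n : nat)
    (A X : 'M[C]_n) : is_core_ep_inverse A X ->
  [/\ A *m X ^+ 2 = X, (A *m X)^t* = A *m X &
      A *m X *m A ^+ mxindex A = A ^+ mxindex A].
Proof.
by move=> [A1 [A2 [d [r [m [U [T [S [N [b ->]]]]]]]]]]; exact: core_ep_block_props d b.
Qed.

Lemma is_core_ep_inverse_unique (C : numClosedFieldType) (n : nat)
    (A X Y : 'M[C]_n) :
  is_core_ep_inverse A X -> is_core_ep_inverse A Y -> X = Y.
Proof.
move=> /is_core_ep_inverse_props[X1 X2 X3] /is_core_ep_inverse_props[Y1 Y2 Y3].
apply: (@outer_inj _ _ A) => //.
have rng Z W : A *m Z ^+ 2 = Z -> A *m W *m A ^+ mxindex A = A ^+ mxindex A ->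
    A *m W *m (A *m Z) = A *m Z.
  move=> Z1 W3; rewrite {1 2}(expmx_outer (mxindex A) Z1).
  have AAk : A *m A ^+ mxindex A = A ^+ mxindex A *m A.
    by rewrite -[LHS]exprS exprSr.
  by rewrite (mulmxA A (A ^+ _)) AAk -[_ *m A *m _]mulmxA mulmxA W3.
rewrite -{1}X2 -{1}(rng X Y X1 Y3) trCmx_mul X2 Y2.
exact: rng.
Qed.

Lemma core_ep_inverse_exists (C : numClosedFieldType) (n : nat)
    (A : 'M[C]_n) : exists X, is_core_ep_inverse A X.
Proof.
pose k := mxindex A; pose P := A ^+ k; pose V := P^t*.
have [k0 rk] : (0 < k)%N /\ \rank (A ^+ k.+1) = \rank P := mxindexP A.
pose r := \rank V; pose m := \rank (orthomx Num.conj 1%:M V).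
have e : (r + m)%N = n by exact: add_rank_ortho.
have [Q1 [Q2 [Qu VQ]]] : exists (Q1 : 'M[C]_(r, n)) (Q2 : 'M[C]_(m, n)),
    col_mx Q1 Q2 \is unitarymx /\ (V :=: Q1)%MS.
  eexists; eexists; split; first exact: schmidt_complete_unitarymx.
  apply: eqmx_sym; apply: eqmx_trans (eq_row_base V).
  by apply: eqmx_schmidt_free; rewrite row_base_free.
have QQ : col_mx Q1 Q2 *m (col_mx Q1 Q2)^t* = 1%:M by apply/unitarymxP.
have QQ' : (col_mx Q1 Q2)^t* *m col_mx Q1 Q2 = 1%:M by apply: unitary_tCmul.
move: QQ; rewrite tr_col_mx map_row_mx mul_col_row scalar_mx_block.
move=> /eq_block_mx[q11 q12 q21 q22].
have q1 : Q1^t* *m Q1 + Q2^t* *m Q2 = 1%:M.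
  by rewrite -QQ' tr_col_mx map_row_mx mul_row_col.
have [D eD] : exists D, P = Q1^t* *m D.
  have /submxP[D eD] : (V <= Q1)%MS by rewrite VQ.
  by exists (D^t*); rewrite -trCmx_mul -eD trmxCK.
have [E eE] : exists E, Q1^t* = P *m E.
  have /submxP[E eE] : (Q1 <= V)%MS by rewrite -VQ.
  by exists (E^t*); rewrite eE trCmx_mul trmxCK.
have AP : A *m P = P *m A by rewrite -[LHS]exprS exprSr.
pose T := Q1 *m A *m Q1^t*.
have AQ : A *m Q1^t* = Q1^t* *m T.
  have h : A *m Q1^t* = Q1^t* *m (D *m A *m E).
    by rewrite {1}eE mulmxA AP eD !mulmxA.
  by rewrite /T -[Q1 *m A *m _]mulmxA h [Q1 *m (_ *m _)]mulmxA q11 mul1mx.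
have Q2AQ1 : Q2 *m A *m Q1^t* = 0 by rewrite -mulmxA AQ mulmxA q21 mul0mx.
have Q2A : Q2 *m A = Q2 *m A *m Q2^t* *m Q2.
  by rewrite -[LHS]mulmx1 -q1 mulmxDr !mulmxA Q2AQ1 mul0mx add0r.
have Q2P : Q2 *m P = 0 by rewrite eD mulmxA q21 mul0mx.
pose N := Q2 *m A *m Q2^t*; pose S := Q1 *m A *m Q2^t*.
have N_exp j : Q2 *m A ^+ j = N ^+ j *m Q2.
  elim: j => [|j IH]; first by rewrite mulmx1 mul1mx.
  by rewrite [in LHS]exprSr -[_ * A]/(_ *m A) mulmxA IH -mulmxA Q2A -/N mulmxA exprSr.
have Nk : N ^+ k = 0.
  by rewrite -[LHS]mulmx1 -q22 mulmxA -N_exp Q2P mul0mx.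
have Tu : T \in unitmx.
  rewrite -row_full_unit -col_leq_rank.
  have : (\rank (Q1^t* *m (T *m D)) <= \rank T)%N.
    by rewrite mulmxA (leq_trans (mxrankM_maxl _ _)) ?mxrankM_maxr.
  apply: leq_trans; rewrite mulmxA -AQ -mulmxA -eD -[A *m P]exprS rk.
  by rewrite /r /V mxrank_map mxrank_tr.
pose U := (col_mx Q1 Q2)^t*.
have Uu : U \is unitarymx by apply: unitarymx_trC.
have UU : U^t* *m U = 1%:M by apply: unitary_tCmul.
pose A1 := U *m block_mx T S 0 0 *m U^t*.
pose A2 := U *m block_mx 0 0 0 N *m U^t*.
have UUK p (M : 'M[C]_(r + m, p)) (M' : 'M[C]_(p, r + m)) : 
    U^t* *m (U *m M) = M by rewrite mulmxA UU mul1mx.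
have eA : A = A1 + A2.
  rewrite -mulmxDl -mulmxDr add_block_mx !(addr0, add0r).
  have <- : U^t* *m A *m U = block_mx T S 0 N.
    by rewrite /U trmxCK tr_col_mx map_row_mx mul_col_mx mul_col_row Q2AQ1.
  by rewrite !mulmxA (unitarymxP Uu) mul1mx -mulmxA (unitarymxP Uu) mulmx1.
exists (U *m block_mx (invmx T) 0 0 0 *m U^t*), A1, A2; split; last first.
  by exists r, m, U, T, S, N; split=> //; split=> //; split=> //; exists k.
split=> //.
- apply/eqP; rewrite eqn_leq; have [-> _] := mxindexP A1; rewrite andbT.
  apply: mxindex_min => //; apply/eqP; rewrite eqn_leq mxrank_expS_le expr1 /=.
  have {1}-> : A1 = U *m block_mx (invmx T) 0 0 0 *m U^t* *m A1 ^+ 2.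
    rewrite expr2 -[A1 * A1]/(A1 *m A1) /A1 -!mulmxA !UUK //.
    congr (_ *m _); rewrite !mulmxA !mulmx_block.
    by rewrite !(mulmx0, mul0mx, addr0, add0r) mulVmx // !mul1mx.
  by have := mxrankM_maxr (U *m block_mx (invmx T) 0 0 0 *m U^t*)
    (A1 ^+ 2 : 'M_n).
- suff h j : A2 ^+ j.+1 = Q2^t* *m N ^+ j.+1 *m Q2.
    by have := h k.-1; rewrite prednK // Nk mulmx0 mul0mx.
  elim: j => [|j IH].
    rewrite !expr1 /A2 /U trmxCK tr_col_mx map_row_mx mul_row_block.
    by rewrite !(mulmx0, addr0, add0r) mul_row_col mul0mx add0r.
  rewrite exprSr IH [in RHS]exprSr -[_ * A2]/(_ *m A2) -[_ * N]/(_ *m N).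
  have -> : A2 = Q2^t* *m N *m Q2.
    rewrite /A2 /U trmxCK tr_col_mx map_row_mx mul_row_block.
    by rewrite !(mulmx0, addr0, add0r) mul_row_col mul0mx add0r.
  by rewrite !mulmxA -[_ *m Q2 *m Q2^t*]mulmxA q22 mulmx1.
- rewrite /A1 /A2 !trCmx_mul trmxCK -!mulmxA UUK //.
  rewrite [X in U *m X]mulmxA.
  rewrite tr_block_mx map_block_mx mulmx_block !trmx0 !map_mx0.
  by rewrite !(mulmx0, mul0mx, addr0) block_mx0 mul0mx mulmx0.
- rewrite /A1 /A2 -!mulmxA UUK // [X in U *m X]mulmxA.
  rewrite mulmx_block !(mulmx0, mul0mx, addr0).
  by rewrite block_mx0 mul0mx mulmx0.
Qed.

Lemma core_ep_inverseP (C : numClosedFieldType) (n : nat) (A X : 'M[C]_n) :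
  is_core_ep_inverse A X <-> X = core_ep_inverse A.
Proof.
have cA : is_core_ep_inverse A (core_ep_inverse A).
  have [Y AY] := core_ep_inverse_exists A.
  by rewrite /core_ep_inverse; case: xgetP => [? _ //|/(_ Y)].
by split=> [AX|->//]; exact: is_core_ep_inverse_unique AX cA.
Qed.

Lemma wg_inverseP (C : numClosedFieldType) (n : nat) (A X : 'M[C]_n) :
  is_wg_inverse A X <-> X = wg_inverse A.
Proof.
have uniq Y Z : is_wg_inverse A Y -> is_wg_inverse A Z -> Y = Z.
  by move=> [Y1 Y2] [Z1 Z2]; apply: outer_inj Y1 Z1 _; rewrite Y2 Z2.
have wA : is_wg_inverse A (wg_inverse A).
  rewrite /wg_inverse; case: xgetP => [? _ //|].
  pose Y := core_ep_inverse A.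
  have /is_core_ep_inverse_props[+ _ _] : is_core_ep_inverse A Y.
    exact/core_ep_inverseP.
  rewrite -[Y ^+ 2]/(Y *m Y) => AYY.
  have AYY' : A *m Y *m Y = Y by rewrite -mulmxA.
  move=> /(_ (Y *m Y *m A)) []; split; last by rewrite mulmxA AYY.
  by rewrite -[(Y *m Y *m A) ^+ 2]/(Y *m Y *m A *m (Y *m Y *m A)) !mulmxA
    AYY' -[Y *m A *m Y *m Y]mulmxA -(mulmxA Y A) AYY.
by split=> [AX|->//]; exact: uniq AX wA.
Qed.

(* Main.v *)
Require Import Defs.
From mathcomp Require Import all_boot all_order all_algebra.
From mathcomp Require Import reals complex.
Local Open Scope ring_scope.
Local Open Scope sesquilinear_scope.

(** Write [X] for the core-EP inverse of [A], [W] for its weak group inverse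
    and [k] for its index.  Both sides of the equivalence say that [A] and [B]
    agree on the range of [A ^+ k], and that [A^t*] and [B^t*] do so too.

    Indeed [X] inverts [A] on this range ([core_ep_inverse_mulA_expr]) and
    [A X] is the orthogonal projector onto it, and [W = X X A]
    ([wg_inverseE]).  Hence [X] and [W] have the same range: [W = X (X A)] and
    [X = W (A X)] ([wg_inverse_mulAX]), so that [A X = B X] and [A W = B W] are
    the same condition.  For the other pair, [X A = X B] reads
    [A^t* X^t* = B^t* X^t*] after taking adjoints, and [A X] being a
    self-adjoint projector, the range of [X^t*] is again that of [A X], thus of
    [X] and of [W]: the factorizations [X = X^t* (A^t* X)] and
    [X = (X (A A X)^t* ) X^t*] carry out the exchange of [X] and [X^t*]. *)

Import GRing.Theory.

Section CoreEP.

Context {C : numClosedFieldType} {n : nat}.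
Implicit Types A B : 'M[C]_n.

Local Notation "A ^ep" := (core_ep_inverse A) (at level 2, format "A ^ep").
Local Notation "A ^wg" := (wg_inverse A) (at level 2, format "A ^wg").

Lemma core_ep_inverse_props A :
  [/\ A *m (A^ep *m A^ep) = A^ep, (A *m A^ep)^t* = A *m A^ep &
      A *m A^ep *m A ^+ mxindex A = A ^+ mxindex A].
Proof. by apply: is_core_ep_inverse_props; apply/core_ep_inverseP. Qed.

Lemma mulmx_exprC A k : A *m A ^+ k = A ^+ k *m A.
Proof. by rewrite -[LHS]exprS exprSr. Qed.

(** [A] is injective on the range of [A ^+ k], where [k] is its index, so the
    identity can be checked after multiplication by [A], where it says that
    the projector [A A^ep] fixes [A ^+ k.+1]. *)
Lemma core_ep_inverse_mulA_expr A :
  A^ep *m A *m A ^+ mxindex A = A ^+ mxindex A.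
Proof.
have [AXX _ PAk] := core_ep_inverse_props A; set k := mxindex A in PAk *.
have [_ rk] := mxindexP A.
have eX : A^ep = A ^+ k *m A^ep ^+ k.+1 by exact: expmx_outer.
apply/eqP; rewrite -subr_eq0; apply/eqP.
have -> : A^ep *m A *m A ^+ k - A ^+ k
    = A ^+ k *m (A^ep ^+ k.+1 *m (A *m A ^+ k) - 1%:M).
  by rewrite mulmxBr mulmx1 !mulmxA -eX.
apply: (@mxrankM_ker _ _ _ _ A); first by rewrite -[A *m _]exprS.
rewrite mulmxBr mulmx1 -[A *m A ^+ k *m _]mulmxA (mulmxA (A ^+ k)) -eX.
by rewrite mulmxA mulmx_exprC mulmxA PAk subrr.
Qed.

Lemma core_ep_inverse_outer A : A^ep *m A *m A^ep = A^ep.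
Proof.
have [AXX _ _] := core_ep_inverse_props A.
rewrite {2 3}(expmx_outer (mxindex A) AXX).
by rewrite mulmxA core_ep_inverse_mulA_expr.
Qed.

(** Both factors of [A *m A^ep] preserve the range of [A ^+ k], on which
    [A^ep] inverts [A]. *)
Lemma core_ep_inverse_projE A : A^ep *m (A *m A *m A^ep) = A *m A^ep.
Proof.
have [AXX _ _] := core_ep_inverse_props A.
rewrite {2 3}(expmx_outer (mxindex A) AXX) -mulmxA !(mulmxA A (A ^+ _)).
rewrite mulmx_exprC -(mulmxA (A ^+ _)) !mulmxA.
by rewrite core_ep_inverse_mulA_expr.
Qed.

(** Substitute [A W = X A] twice in [W = A W W]. *)
Lemma wg_inverseE A : A^wg = A^ep *m A^ep *m A.
Proof.
have [AWW AW] : is_wg_inverse A A^wg by apply/wg_inverseP.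
rewrite -{1}AWW -[_ ^+ 2]/(_ *m _) mulmxA AW -mulmxA AW.
exact: mulmxA.
Qed.

(** The range of the core-EP inverse lies in that of the weak group inverse;
    [wg_inverseE] gives the converse inclusion. *)
Lemma wg_inverse_mulAX A : A^wg *m (A *m A^ep) = A^ep.
Proof.
rewrite wg_inverseE -!mulmxA (mulmxA A A) core_ep_inverse_projE mulmxA.
exact: core_ep_inverse_outer.
Qed.

(** The range of [A^ep] lies in that of its adjoint, by self-adjointness of
    [A A^ep]. *)
Lemma core_ep_inverse_adjl A : A^ep = A^ep^t* *m (A^t* *m A^ep).
Proof.
have [AXX AXh _] := core_ep_inverse_props A.
by rewrite mulmxA -trCmx_mul AXh -mulmxA AXX.
Qed.

(** The row space of [A^ep] lies in that of its adjoint, by self-adjointness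
    of [A A^ep], which factors through [A^ep] on the left. *)
Lemma core_ep_inverse_adjr A :
  A^ep = A^ep *m (A *m A *m A^ep)^t* *m A^ep^t*.
Proof.
have [_ AXh _] := core_ep_inverse_props A.
rewrite -mulmxA -trCmx_mul core_ep_inverse_projE AXh mulmxA.
by rewrite core_ep_inverse_outer.
Qed.

Lemma core_ep_le_wg_inverse A B :
  core_ep_le A B <-> (A *m A^wg = B *m A^wg /\ A^t* *m A^wg = B^t* *m A^wg).
Proof.
split=> -[].
  move=> XAB AXB; split; first by rewrite wg_inverseE !mulmxA AXB.
  suff AhX : A^t* *m A^ep = B^t* *m A^ep by rewrite wg_inverseE !mulmxA AhX.
  rewrite core_ep_inverse_adjl mulmxA [in RHS]mulmxA.
  by congr (_ *m _); rewrite -!trCmx_mul XAB.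
move=> AWB AhWB; split; last by rewrite -wg_inverse_mulAX mulmxA AWB -mulmxA.
have AhX : A^t* *m A^ep = B^t* *m A^ep.
  by rewrite -wg_inverse_mulAX mulmxA AhWB -mulmxA.
have XhA : A^ep^t* *m A = A^ep^t* *m B.
  by rewrite -[A in _ *m A]trmxCK -[B]trmxCK -!(trCmx_mul _ A^ep) AhX.
by rewrite core_ep_inverse_adjr -mulmxA XhA mulmxA.
Qed.

End CoreEP.

Theorem theorem5p2 (R : realType) (n : nat) (A B : 'M[R[i]]_n) :
  core_ep_le A B <->
  (A *m wg_inverse A = B *m wg_inverse A /\
   A^t* *m wg_inverse A = B^t* *m wg_inverse A).
Proof. exact: core_ep_le_wg_inverse. Qed.
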